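(* Consider an Abel equation $$\frac{dx}{dt}=f_0(t)+f_1(t)x+f_2(t)x^2+f_3(t)x^3$$ with $f_3(t)>0$ for every $t\in\mathbb{R}$, and let $c_0,c_1,c_2,c_3\in\mathbb{R}$ with $c_3c_2\neq 0$. The equation is a quasi-Lie system with respect to the quasi-Lie scheme $S(W_{\rm Abel},V_{\rm Abel})$ and the one-dimensional Lie algebra $V=\left\langle (c_3x^3+c_2x^2+c_1x+c_0)\frac{\partial}{\partial x}\right\rangle$ if and only if the system $$\begin{gathered} \frac{c_1c_3(3f_3\beta+f_2)^2}{c_2^2f_3}=3f_3\beta^2+2f_2\beta+f_1+\frac{f_2\dot f_3-f_3\dot f_2-3f_3^2\dot \beta}{f_3(f_2+3f_3\beta)},\\ \frac{c_3^2c_0(3f_3\beta+f_2)^3}{c_2^3f_3^2}=f_3\beta^3+f_2\beta^2+f_1\beta+f_0-\dot\beta \end{gathered}$$ admits a particular solution $\beta=\beta(t)$. Given such a solution, setting $$\alpha=c_3\frac{3f_3\beta+f_2}{c_2f_3},$$ the transformation $x(t)=\alpha(t)\bar x(t)+\beta(t)$ maps the Abel equation onto a Lie system with Vessiot--Guldberg Lie algebra $V$.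
   Context: All functions are smooth functions of $t\in\mathbb{R}$; a dot denotes $d/dt$. A solution $\beta$ of the displayed system is understood to satisfy $f_2+3f_3\beta\neq0$ for all $t$, so that the denominators make sense. Let $Y_k=x^k\,\partial/\partial x$ on $\mathbb{R}$, $V_{\rm Abel}=\langle Y_0,Y_1,Y_2,Y_3\rangle$ and $W_{\rm Abel}=\langle Y_0,Y_1\rangle$; these form a quasi-Lie scheme, i.e. $[W_{\rm Abel},W_{\rm Abel}]\subset W_{\rm Abel}\subset V_{\rm Abel}$ and $[W_{\rm Abel},V_{\rm Abel}]\subset V_{\rm Abel}$. The group $G_{W_{\rm Abel}}=\mathbb{R}\rtimes\mathbb{R}_*$ ($\mathbb{R}_*=\mathbb{R}\setminus\{0\}$) acts on $\mathbb{R}$ by $(\beta,\alpha)\cdot x=\alpha x+\beta$. The equation is identified with the $t$-dependent vector field $X=\sum_{k=0}^3f_k(t)Y_k$. A curve $g$ in $G_{W_{\rm Abel}}$ acts on $X$ by $(g_\bigstar X)_t=\frac{\partial g_t}{\partial t}\circ g_t^{-1}+g_{t*}X_t$; in other words, if $g^{-1}_t=(\beta(t),\alpha(t))$ with $\alpha(t)\ne0$, then $g_\bigstar X$ is the $t$-dependent vector field of the equation obtained for $\bar x$ after the change of variables $x=\alpha(t)\bar x+\beta(t)$. The equation $X$ is a quasi-Lie system with respect to $S(W_{\rm Abel},V_{\rm Abel})$ and a Lie algebra $V\subset V_{\rm Abel}$ if there is a curve $g$ in $G_{W_{\rm Abel}}$ such that $(g_\bigstar X)_t\in V$ for all $t$.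 A Lie system with Vessiot--Guldberg Lie algebra $V$ is a $t$-dependent vector field taking values in the finite-dimensional Lie algebra $V$; here this means it has the form $\xi(t)(c_3x^3+c_2x^2+c_1x+c_0)\,\partial/\partial x$. *)

(* Defs.v *)
From Stdlib Require Import Reals.
From Coquelicot Require Import Coquelicot.
Open Scope R_scope.

Definition smooth (f : R -> R) : Prop := forall n t, ex_derive_n f n t.

(** A vector field [v(x) d/dx] on the line is represented by its coefficient
    [v]; a time-dependent vector field [X] sends [t] to the vector field [X t]. *)
Definition vfield : Type := R -> R.
Definition tvfield : Type := R -> vfield.

(** [[v d/dx, w d/dx] = (v w' - w v') d/dx]. *)
Definition bracket (v w : vfield) : vfield :=
  fun x => v x * Derive w x - w x * Derive v x.

(** The linear span of the [n + 1] vector fields [Y 0, ..., Y n]. *)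
Definition span (Y : nat -> vfield) (n : nat) (v : vfield) : Prop :=
  exists c : nat -> R, forall x, v x = sum_n (fun k => c k * Y k x) n.

Definition findim_space (V : vfield -> Prop) : Prop :=
  exists (n : nat) (Y : nat -> vfield),
    (forall k, smooth (Y k)) /\ forall v, V v <-> span Y n v.

Definition included (U V : vfield -> Prop) : Prop := forall v, U v -> V v.

Definition bracket_included (U V W : vfield -> Prop) : Prop :=
  forall u v, U u -> V v -> W (bracket u v).

Definition lie_algebra (V : vfield -> Prop) : Prop :=
  findim_space V /\ bracket_included V V V.

Definition quasi_lie_scheme (W V : vfield -> Prop) : Prop :=
  findim_space W /\ findim_space V /\ included W V /\
  bracket_included W W W /\ bracket_included W V V.

Definition Y (k : nat) : vfield := fun x => x ^ k.
Definition V_Abel : vfield -> Prop := span Y 3.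
Definition W_Abel : vfield -> Prop := span Y 1.

(** The semidirect product of the additive group of the reals (component
    [trans]) with the multiplicative group of nonzero reals (component
    [scale]), acting on the line by affine transformations. *)
Record affine : Type := Affine {
  trans : R;
  scale : R;
  scale_neq0 : scale <> 0
}.

Definition act (g : affine) (x : R) : R := scale g * x + trans g.

Definition inv (g : affine) : affine :=
  Affine (- (trans g / scale g)) (/ scale g)
         (Rinv_neq_0_compat _ (scale_neq0 g)).

Lemma act_inv_l (g : affine) (x : R) : act (inv g) (act g x) = x.
Proof. unfold act, inv; simpl; field; apply scale_neq0. Qed.

Lemma act_inv_r (g : affine) (x : R) : act g (act (inv g) x) = x.
Proof. unfold act, inv; simpl; field; apply scale_neq0. Qed.

Definition smooth_curve (g : R -> affine) : Prop :=
  smooth (fun t => trans (g t)) /\ smooth (fun t => scale (g t)).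

Definition pushforward (g : affine) (v : vfield) : vfield :=
  fun y => Derive (act g) (act (inv g) y) * v (act (inv g) y).

(** The action of a curve on a time-dependent vector field:
    [(dg_t/dt) o g_t^-1 + g_t* X_t]. *)
Definition gstar (g : R -> affine) (X : tvfield) : tvfield :=
  fun t y =>
    Derive (fun s => act (g s) (act (inv (g t)) y)) t
    + pushforward (g t) (X t) y.

(** [X] is a quasi-Lie system with respect to [S(W_Abel, V_Abel)] and the Lie
    algebra [V]; the affine group is the one attached to [W_Abel]. *)
Definition abel_quasi_lie_system (V : vfield -> Prop) (X : tvfield) : Prop :=
  quasi_lie_scheme W_Abel V_Abel /\
  (forall t, V_Abel (X t)) /\
  lie_algebra V /\ included V V_Abel /\
  exists g : R -> affine, smooth_curve g /\ forall t, V (gstar g X t).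

Definition lie_system (V : vfield -> Prop) (X : tvfield) : Prop :=
  lie_algebra V /\ forall t, V (X t).

Definition abel (f0 f1 f2 f3 : R -> R) : tvfield :=
  fun t x => f0 t * Y 0 x + f1 t * Y 1 x + f2 t * Y 2 x + f3 t * Y 3 x.

Definition cubic (c0 c1 c2 c3 : R) : vfield :=
  fun x => c3 * x ^ 3 + c2 * x ^ 2 + c1 * x + c0.

Definition line (v : vfield) : vfield -> Prop := span (fun _ => v) 0.

Definition solution_on (X : tvfield) (a b : Rbar) (x : R -> R) : Prop :=
  forall t : R, Rbar_lt a t -> Rbar_lt t b -> is_derive x t (X t (x t)).

(** The change of variables [x(t) = alpha(t) xbar(t) + beta(t)] maps the
    equation of [X] (unknown [x]) onto the equation of [Z] (unknown [xbar]). *)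
Definition maps_onto (alpha beta : R -> R) (X Z : tvfield) : Prop :=
  forall (a b : Rbar) (xbar : R -> R),
    solution_on X a b (fun t => alpha t * xbar t + beta t) <->
    solution_on Z a b xbar.

Definition system_solution (f0 f1 f2 f3 : R -> R) (c0 c1 c2 c3 : R)
    (beta : R -> R) : Prop :=
  smooth beta /\
  forall t : R,
    f2 t + 3 * f3 t * beta t <> 0 /\
    c1 * c3 * (3 * f3 t * beta t + f2 t) ^ 2 / (c2 ^ 2 * f3 t)
      = 3 * f3 t * beta t ^ 2 + 2 * f2 t * beta t + f1 t
        + (f2 t * Derive f3 t - f3 t * Derive f2 t
           - 3 * f3 t ^ 2 * Derive beta t)
          / (f3 t * (f2 t + 3 * f3 t * beta t)) /\
    c3 ^ 2 * c0 * (3 * f3 t * beta t + f2 t) ^ 3 / (c2 ^ 3 * f3 t ^ 2)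
      = f3 t * beta t ^ 3 + f2 t * beta t ^ 2 + f1 t * beta t + f0 t
        - Derive beta t.

(* Main.v *)
(** In the variable [y] defined by [x = alpha y + beta] the equation reads
    [y' = (X_t (alpha y + beta) - alpha' y - beta') / alpha].  Comparing the
    four coefficients of this cubic with those of [xi * cubic c0 c1 c2 c3], the
    coefficients of degrees 3 and 2 force
    [alpha = c3 (3 f3 beta + f2) / (c2 f3)] and [xi = f3 alpha^2 / c3], and then
    those of degrees 1 and 0 are the two equations of the system. *)

Require Import Defs.
From Stdlib Require Import Reals Lra Lia.
From Coquelicot Require Import Coquelicot.
Open Scope R_scope.

(** * Closure properties of smooth functions *)

Fixpoint differentiable_upto (n : nat) (f : R -> R) : Prop :=
  match n with
  | O => True
  | S m => (forall t, ex_derive f t) /\ differentiable_upto m (Derive f)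
  end.

Lemma differentiable_upto_ext (n : nat) (f g : R -> R) :
  (forall t, f t = g t) -> differentiable_upto n f -> differentiable_upto n g.
Proof.
revert f g; induction n as [|n IH]; intros f g Hfg Hf; [exact I|].
destruct Hf as [Hf Hf']; split.
- intros t; apply (ex_derive_ext f); auto.
- apply (IH (Derive f)); auto.
  intros t; apply Derive_ext; auto.
Qed.

Lemma differentiable_upto_S (n : nat) (f : R -> R) :
  differentiable_upto (S n) f -> differentiable_upto n f.
Proof.
revert f; induction n as [|n IH]; intros f Hf; [exact I|].
destruct Hf as [Hf Hf']; split; auto.
Qed.

Lemma smooth_ex_derive (f : R -> R) (t : R) : smooth f -> ex_derive f t.
Proof. intros Hf; exact (Hf 1%nat t). Qed.

Lemma smooth_ext (f g : R -> R) :
  (forall t, f t = g t) -> smooth f -> smooth g.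
Proof. intros Hfg Hf n t; apply (ex_derive_n_ext f); auto. Qed.

Lemma Derive_n_Derive (f : R -> R) (n : nat) (t : R) :
  Derive_n (Derive f) n t = Derive_n f (S n) t.
Proof.
replace (S n) with (n + 1)%nat by lia.
exact (Derive_n_comp f n 1 t).
Qed.

Lemma smooth_Derive (f : R -> R) : smooth f -> smooth (Derive f).
Proof.
intros Hf [|n] t; [exact I|].
apply (ex_derive_ext (Derive_n f (S n))).
- intros s; symmetry; apply Derive_n_Derive.
- exact (Hf (S (S n)) t).
Qed.

(** [ex_derive_n] peels off the outermost derivative, whereas [differentiable_upto] replaces [f] by
    [Derive f] first. With the second form, the sum, product and inverse rules are applied once and
    the induction hypothesis handles the resulting derivative. *)
Lemma smoothP (f : R -> R) :
  smooth f <-> forall n, differentiable_upto n f.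
Proof.
split.
- intros Hf n; revert f Hf; induction n as [|n IH]; intros f Hf; [exact I|].
  split.
  + intros t; apply smooth_ex_derive, Hf.
  + apply IH, smooth_Derive, Hf.
- intros Hf n; generalize (Hf n); clear Hf.
  revert f; induction n as [|n IH]; intros f Hf t; [exact I|].
  destruct Hf as [Hf Hf'].
  destruct n as [|n]; [exact (Hf t)|].
  apply (ex_derive_ext (Derive_n (Derive f) n)).
  + intros s; apply Derive_n_Derive.
  + exact (IH _ Hf' t).
Qed.

Lemma smooth_const (c : R) : smooth (fun _ => c).
Proof. intros n t; apply ex_derive_n_const. Qed.

Lemma smooth_id : smooth (fun x => x).
Proof.
apply smoothP; intros [|n]; [exact I|]; split.
- intros t; apply ex_derive_id.
- apply (differentiable_upto_ext n (fun _ => 1)).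
  + intros t; symmetry; apply Derive_id.
  + apply smoothP, smooth_const.
Qed.

Lemma differentiable_upto_plus (n : nat) (f g : R -> R) :
  differentiable_upto n f -> differentiable_upto n g ->
  differentiable_upto n (fun t => f t + g t).
Proof.
revert f g; induction n as [|n IH]; intros f g Hf Hg; [exact I|].
destruct Hf as [Hf Hf'], Hg as [Hg Hg']; split.
- intros t; apply @ex_derive_plus; auto.
- apply (differentiable_upto_ext n (fun t => Derive f t + Derive g t)); auto.
  intros t; symmetry; apply Derive_plus; auto.
Qed.

Lemma differentiable_upto_mult (n : nat) (f g : R -> R) :
  differentiable_upto n f -> differentiable_upto n g ->
  differentiable_upto n (fun t => f t * g t).
Proof.
revert f g; induction n as [|n IH]; intros f g Hf Hg; [exact I|].
(* The derivative [f' g + f g'] still contains [f] and [g], which are therefore needed at order [n]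
   as well. *)
assert (Hfn := differentiable_upto_S _ _ Hf).
assert (Hgn := differentiable_upto_S _ _ Hg).
destruct Hf as [Hf Hf'], Hg as [Hg Hg']; split.
- intros t; apply ex_derive_mult; auto.
- apply (differentiable_upto_ext n
           (fun t => Derive f t * g t + f t * Derive g t)).
  + intros t; symmetry; apply Derive_mult; auto.
  + apply differentiable_upto_plus; auto.
Qed.

Lemma smooth_plus (f g : R -> R) :
  smooth f -> smooth g -> smooth (fun t => f t + g t).
Proof.
rewrite !smoothP; intros Hf Hg n; apply differentiable_upto_plus; auto.
Qed.

Lemma smooth_mult (f g : R -> R) :
  smooth f -> smooth g -> smooth (fun t => f t * g t).
Proof.
rewrite !smoothP; intros Hf Hg n; apply differentiable_upto_mult; auto.
Qed.

Lemma smooth_opp (f : R -> R) : smooth f -> smooth (fun t => - f t).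
Proof.
intros Hf; apply (smooth_ext (fun t => -1 * f t)).
- intros t; ring.
- exact (smooth_mult _ _ (smooth_const (-1)) Hf).
Qed.

Lemma smooth_pow (f : R -> R) (n : nat) :
  smooth f -> smooth (fun t => f t ^ n).
Proof.
intros Hf; induction n as [|n IH]; [exact (smooth_const 1)|].
exact (smooth_mult _ _ Hf IH).
Qed.

(** Since [(1/f)' = - f' (1/f)^2], differentiability of [1/f] up to order [n] bootstraps to order
    [n + 1], with [f] fixed throughout the induction. *)
Lemma smooth_inv (f : R -> R) :
  (forall t, f t <> 0) -> smooth f -> smooth (fun t => / f t).
Proof.
intros Hf0 Hf; apply smoothP; intros n; induction n as [|n IH]; [exact I|].
assert (Df := fun t => smooth_ex_derive f t Hf).
split.
- intros t; apply ex_derive_inv; auto.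
- apply (differentiable_upto_ext n (fun t => (- Derive f t) * (/ f t * / f t))).
  + intros t; rewrite Derive_inv; auto; field; auto.
  + apply differentiable_upto_mult.
    * exact (proj1 (smoothP _) (smooth_opp _ (smooth_Derive _ Hf)) n).
    * apply differentiable_upto_mult; exact IH.
Qed.

Lemma smooth_div (f g : R -> R) :
  (forall t, g t <> 0) -> smooth f -> smooth g -> smooth (fun t => f t / g t).
Proof.
intros Hg0 Hf Hg; apply smooth_mult; [exact Hf|]; apply smooth_inv; auto.
Qed.

(** * Polynomial vector fields, the quasi-Lie scheme and one-dimensional Lie algebras *)

Lemma W_AbelP (v : vfield) :
  W_Abel v <-> exists a0 a1 : R, forall x, v x = a0 + a1 * x.
Proof.
split.
- intros [c Hc]; exists (c 0%nat), (c 1%nat); intros x.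
  rewrite Hc, !sum_Sn, sum_O; unfold Y, plus; simpl; ring.
- intros (a0 & a1 & Hv).
  exists (fun k => match k with 0%nat => a0 | _ => a1 end); intros x.
  rewrite Hv, !sum_Sn, sum_O; unfold Y, plus; simpl; ring.
Qed.

Lemma V_AbelP (v : vfield) :
  V_Abel v <-> exists a0 a1 a2 a3 : R,
    forall x, v x = a0 + a1 * x + a2 * x ^ 2 + a3 * x ^ 3.
Proof.
split.
- intros [c Hc]; exists (c 0%nat), (c 1%nat), (c 2%nat), (c 3%nat); intros x.
  rewrite Hc, !sum_Sn, sum_O; unfold Y, plus; simpl; ring.
- intros (a0 & a1 & a2 & a3 & Hv).
  exists (fun k => match k with
                   | 0%nat => a0 | 1%nat => a1 | 2%nat => a2 | _ => a3 end).
  intros x; rewrite Hv, !sum_Sn, sum_O; unfold Y, plus; simpl; ring.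
Qed.

Lemma lineP (v w : vfield) :
  line v w <-> exists c : R, forall x, w x = c * v x.
Proof.
split.
- intros [c Hc]; exists (c 0%nat); intros x; rewrite Hc, sum_O; reflexivity.
- intros [c Hc]; exists (fun _ => c); intros x; rewrite Hc, sum_O; reflexivity.
Qed.

Lemma Derive_cubic (a0 a1 a2 a3 : R) (v : vfield) (x : R) :
  (forall x, v x = a0 + a1 * x + a2 * x ^ 2 + a3 * x ^ 3) ->
  Derive v x = a1 + 2 * a2 * x + 3 * a3 * x ^ 2.
Proof.
intros Hv; apply is_derive_unique.
apply (is_derive_ext (fun x => a0 + a1 * x + a2 * x ^ 2 + a3 * x ^ 3)); auto.
auto_derive; [exact I | ring].
Qed.

Lemma findim_span_Y (n : nat) : findim_space (span Y n).
Proof.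
exists n, Y; split; [|tauto].
intros k; exact (smooth_pow _ k smooth_id).
Qed.

Lemma included_W_V_Abel : Defs.included W_Abel V_Abel.
Proof.
intros v Hv; apply W_AbelP in Hv; destruct Hv as (a0 & a1 & Hv).
apply V_AbelP; exists a0, a1, 0, 0; intros x; rewrite Hv; ring.
Qed.

Lemma Derive_affine (a0 a1 : R) (v : vfield) (x : R) :
  (forall x, v x = a0 + a1 * x) -> Derive v x = a1.
Proof.
intros Hv; rewrite (Derive_cubic a0 a1 0 0).
- ring.
- intros z; rewrite Hv; ring.
Qed.

(** Bracketing with an affine field never raises the degree: [[Y_i, Y_j] = (j - i) Y_(i+j-1)] with
    [i <= 1]. The witnesses below are read off from this formula. *)
Lemma quasi_lie_scheme_Abel : quasi_lie_scheme W_Abel V_Abel.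
Proof.
repeat split; try apply findim_span_Y; try apply included_W_V_Abel.
- intros u v Hu Hv; apply W_AbelP in Hu, Hv.
  destruct Hu as (a0 & a1 & Hu), Hv as (b0 & b1 & Hv).
  (* The linear terms [a1 b1 x] cancel, so the bracket of two affine fields is constant. *)
  apply W_AbelP; exists (a0 * b1 - b0 * a1), 0; intros x; unfold bracket.
  rewrite (Derive_affine _ _ _ _ Hu), (Derive_affine _ _ _ _ Hv), Hu, Hv; ring.
- intros u v Hu Hv; apply W_AbelP in Hu; apply V_AbelP in Hv.
  destruct Hu as (a0 & a1 & Hu), Hv as (b0 & b1 & b2 & b3 & Hv).
  apply V_AbelP.
  exists (a0 * b1 - b0 * a1), (2 * a0 * b2), (3 * a0 * b3 + a1 * b2),
    (2 * a1 * b3).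
  intros x; unfold bracket.
  rewrite (Derive_affine _ _ _ _ Hu), (Derive_cubic _ _ _ _ _ _ Hv), Hu, Hv.
  ring.
Qed.

Lemma lie_algebra_line (v : vfield) : smooth v -> lie_algebra (line v).
Proof.
intros Hv; split.
- exists 0%nat, (fun _ => v); split; [intros _; exact Hv | tauto].
- intros u w Hu Hw; apply lineP in Hu, Hw.
  destruct Hu as [a Hu], Hw as [b Hw].
  (* Two constant multiples of the same field commute. *)
  apply lineP; exists 0; intros x; unfold bracket.
  rewrite (Derive_ext _ _ x Hu), (Derive_ext _ _ x Hw), !Derive_scal, Hu, Hw.
  ring.
Qed.

Lemma smooth_cubic (c0 c1 c2 c3 : R) : smooth (cubic c0 c1 c2 c3).
Proof.
assert (Hmon : forall c n, smooth (fun x => c * x ^ n)).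
{ intros c n; exact (smooth_mult _ _ (smooth_const c) (smooth_pow _ n smooth_id)). }
exact (smooth_plus _ _ (smooth_plus _ _ (smooth_plus _ _ (Hmon c3 3%nat)
  (Hmon c2 2%nat)) (smooth_mult _ _ (smooth_const c1) smooth_id))
  (smooth_const c0)).
Qed.

Lemma included_line_cubic (c0 c1 c2 c3 : R) :
  Defs.included (line (cubic c0 c1 c2 c3)) V_Abel.
Proof.
intros v Hv; apply lineP in Hv; destruct Hv as [c Hv].
apply V_AbelP; exists (c * c0), (c * c1), (c * c2), (c * c3); intros x.
rewrite Hv; unfold cubic; ring.
Qed.

Lemma V_Abel_abel (f0 f1 f2 f3 : R -> R) (t : R) : V_Abel (abel f0 f1 f2 f3 t).
Proof.
apply V_AbelP; exists (f0 t), (f1 t), (f2 t), (f3 t); intros x.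
unfold abel, Y; ring.
Qed.

(** A cubic is determined by its values at the four points 0, 1, -1 and 2; the coefficients follow
    by linear algebra. *)
Lemma cubic_eq_coef (a0 a1 a2 a3 b0 b1 b2 b3 : R) :
  (forall y, a0 + a1 * y + a2 * y ^ 2 + a3 * y ^ 3 =
             b0 + b1 * y + b2 * y ^ 2 + b3 * y ^ 3) ->
  a0 = b0 /\ a1 = b1 /\ a2 = b2 /\ a3 = b3.
Proof.
intros H.
assert (H0 := H 0); assert (H1 := H 1); assert (Hm := H (-1)).
assert (H2 := H 2).
simpl in H0, H1, Hm, H2; repeat split; lra.
Qed.

(** * Affine changes of variables and the transformed equation *)

Lemma smooth_curve_inv (g : R -> affine) :
  smooth_curve g -> smooth_curve (fun t => inv (g t)).
Proof.
intros [Hb Ha]; split; simpl.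
- apply smooth_opp, smooth_div; auto; intros t; apply scale_neq0.
- apply smooth_inv; auto; intros t; apply scale_neq0.
Qed.

(** Links the geometric action of [g] to the substitution [x = alpha y + beta], whose coefficients
    are those of the inverse curve. With [scale g = 1 / alpha] and [trans g = - beta / alpha], it
    amounts to comparing the derivatives of the two pairs. *)
Lemma gstarE (g : R -> affine) (X : tvfield) (t y : R) :
  smooth_curve g ->
  let alpha s := scale (inv (g s)) in
  let beta s := trans (inv (g s)) in
  gstar g X t y =
  (X t (alpha t * y + beta t) - Derive alpha t * y - Derive beta t) / alpha t.
Proof.
intros [Hb Ha] alpha beta.
assert (Db := smooth_ex_derive _ t Hb).
assert (Da := smooth_ex_derive _ t Ha).
assert (N := fun s => scale_neq0 (g s)).
assert (Ealpha : Derive alpha t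
                 = - Derive (fun s => scale (g s)) t / scale (g t) ^ 2).
{ unfold alpha; simpl; rewrite Derive_inv; auto. }
assert (Ebeta : Derive beta t
  = - ((Derive (fun s => trans (g s)) t * scale (g t)
        - trans (g t) * Derive (fun s => scale (g s)) t) / scale (g t) ^ 2)).
{ unfold beta; simpl.
  rewrite Derive_opp, Derive_div; auto. }
rewrite Ealpha, Ebeta.
unfold gstar, pushforward.
change (act (inv (g t)) y) with (alpha t * y + beta t).
(* The point [x] is frozen at time [t]: only [g s] varies in the derivative with respect to [s]. *)
set (x := alpha t * y + beta t).
assert (E1 : Derive (fun s => act (g s) x) t
             = Derive (fun s => scale (g s)) t * x
               + Derive (fun s => trans (g s)) t).
{ unfold act; rewrite Derive_plus; auto.
  - rewrite Derive_mult; auto using ex_derive_const.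
    rewrite Derive_const; ring.
  - apply ex_derive_mult; auto using ex_derive_const. }
assert (E2 : Derive (act (g t)) x = scale (g t)).
{ apply (Derive_affine (trans (g t))); intros z; unfold act; ring. }
(* The remaining identity holds for any real number in place of the value of [X t] at [x]. *)
rewrite E1, E2; generalize (X t x); intros r.
unfold x, alpha, beta; simpl; field; auto.
Qed.

(** Taylor expansion of the Abel cubic at [beta t], with increment [alpha t * y], sorted by powers
    of [y] so that coefficients can be compared. *)
Lemma gstar_abelE (g : R -> affine) (f0 f1 f2 f3 : R -> R) (t y : R) :
  smooth_curve g ->
  let alpha s := scale (inv (g s)) in
  let beta s := trans (inv (g s)) in
  gstar g (abel f0 f1 f2 f3) t y =
  (f3 t * beta t ^ 3 + f2 t * beta t ^ 2 + f1 t * beta t + f0 t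
   - Derive beta t) / alpha t
  + (3 * f3 t * beta t ^ 2 + 2 * f2 t * beta t + f1 t
     - Derive alpha t / alpha t) * y
  + alpha t * (3 * f3 t * beta t + f2 t) * y ^ 2
  + f3 t * alpha t ^ 2 * y ^ 3.
Proof.
intros Hg alpha beta; rewrite (gstarE g _ t y Hg).
fold alpha; fold beta.
assert (N : alpha t <> 0) by apply scale_neq0.
change (scale (inv (g t))) with (alpha t).
change (trans (inv (g t))) with (beta t).
unfold abel, Y; field; exact N.
Qed.

Lemma maps_onto_affine (alpha beta : R -> R) (X Z : tvfield) :
  smooth alpha -> smooth beta -> (forall t, alpha t <> 0) ->
  (forall t y, Z t y = (X t (alpha t * y + beta t) - Derive alpha t * y
                        - Derive beta t) / alpha t) ->
  maps_onto alpha beta X Z.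
Proof.
intros Ha Hb N HZ a b xbar.
assert (Dalpha := fun t => Derive_correct _ _ (smooth_ex_derive _ t Ha)).
assert (Dbeta := fun t => Derive_correct _ _ (smooth_ex_derive _ t Hb)).
split; intros Hx t ta tb; specialize (Hx t ta tb).
- rewrite HZ.
  (* Differentiability of [xbar] is not given in this direction; it is recovered by writing [xbar]
     as [(x - beta) / alpha]. *)
  assert (Ex : forall s, (alpha s * xbar s + beta s - beta s) / alpha s = xbar s)
    by (intros s; field; apply N).
  apply (is_derive_ext _ _ _ _ Ex).
  evar_last.
  { exact (is_derive_div _ _ t _ _ (is_derive_minus _ _ t _ _ Hx (Dbeta t))
             (Dalpha t) (N t)). }
  unfold minus, plus, opp; simpl.
  generalize (X t (alpha t * xbar t + beta t)); intros r; field; apply N.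
- rewrite HZ in Hx.
  evar_last.
  { exact (is_derive_plus _ _ t _ _
             (is_derive_mult _ _ t _ _ (Dalpha t) Hx Rmult_comm) (Dbeta t)). }
  unfold plus, mult; simpl.
  generalize (X t (alpha t * xbar t + beta t)); intros r; field; apply N.
Qed.

(** * Comparison of coefficients and the system for [beta] *)

Lemma Derive_alpha (f2 f3 beta : R -> R) (c2 c3 t : R) :
  smooth f2 -> smooth f3 -> smooth beta -> f3 t <> 0 -> c2 <> 0 ->
  Derive (fun t => c3 * ((3 * f3 t * beta t + f2 t) / (c2 * f3 t))) t =
  c3 * (3 * f3 t ^ 2 * Derive beta t + f3 t * Derive f2 t
        - f2 t * Derive f3 t) / (c2 * f3 t ^ 2).
Proof.
intros H2 H3 Hb N3 N2.
apply is_derive_unique; auto_derive.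
- repeat split; try (apply smooth_ex_derive; assumption).
  apply Rmult_integral_contrapositive; auto.
- change (Derive (fun x => f3 x) t) with (Derive f3 t).
  change (Derive (fun x => f2 x) t) with (Derive f2 t).
  change (Derive (fun x => beta x) t) with (Derive beta t).
  field; auto.
Qed.

Lemma system_solution_of_gstar
    (f0 f1 f2 f3 : R -> R) (c0 c1 c2 c3 : R)
    (hf2 : smooth f2) (hf3 : smooth f3) (hf3_pos : forall t, 0 < f3 t)
    (hc2 : c2 <> 0) (hc3 : c3 <> 0) (g : R -> affine) :
  smooth_curve g ->
  (forall t, line (cubic c0 c1 c2 c3) (gstar g (abel f0 f1 f2 f3) t)) ->
  system_solution f0 f1 f2 f3 c0 c1 c2 c3 (fun t => trans (inv (g t))).
Proof.
intros Hg HV.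
destruct (smooth_curve_inv g Hg) as [Hb Ha].
set (alpha := fun t => scale (inv (g t))) in *.
set (beta := fun t => trans (inv (g t))) in *.
assert (N : forall t, alpha t <> 0) by (intros t; apply scale_neq0).
assert (N3 : forall t, f3 t <> 0) by (intros t; apply Rgt_not_eq, hf3_pos).
(* The four coefficient comparisons, in increasing degree, with a factor [xi] chosen separately at
   each time. *)
assert (E : forall t, exists xi,
  (f3 t * beta t ^ 3 + f2 t * beta t ^ 2 + f1 t * beta t + f0 t
   - Derive beta t) / alpha t = xi * c0 /\
  3 * f3 t * beta t ^ 2 + 2 * f2 t * beta t + f1 t
     - Derive alpha t / alpha t = xi * c1 /\
  alpha t * (3 * f3 t * beta t + f2 t) = xi * c2 /\
  f3 t * alpha t ^ 2 = xi * c3).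
{ intros t; destruct (proj1 (lineP _ _) (HV t)) as [xi Hxi]; exists xi.
  apply cubic_eq_coef; intros y.
  transitivity (gstar g (abel f0 f1 f2 f3) t y).
  - symmetry; exact (gstar_abelE g f0 f1 f2 f3 t y Hg).
  - rewrite Hxi; unfold cubic; ring. }
assert (Exi : forall t xi, f3 t * alpha t ^ 2 = xi * c3 ->
                xi = f3 t * alpha t ^ 2 / c3).
{ intros t xi ->; field; exact hc3. }
assert (ED : forall t, 3 * f3 t * beta t + f2 t = f3 t * alpha t * c2 / c3).
(* Degree 3 gives [xi]; inserting it in degree 2 and cancelling one [alpha t] gives the claim. *)
{ intros t; destruct (E t) as (xi & _ & _ & E2 & E3); apply Exi in E3.
  apply (Rmult_eq_reg_l (alpha t)); [|apply N].
  rewrite E2, E3; field; exact hc3. }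
assert (Ealpha : forall t,
  alpha t = c3 * ((3 * f3 t * beta t + f2 t) / (c2 * f3 t))).
{ intros t; rewrite ED; field; auto. }
assert (EDalpha := fun t => Derive_alpha f2 f3 beta c2 c3 t hf2 hf3 Hb (N3 t) hc2).
split; [exact Hb|]; intros t; fold (beta t).
assert (ND : 3 * f3 t * beta t + f2 t <> 0).
(* The denominator in the system cannot vanish, since [alpha t] is a multiple of it and is
   nonzero. *)
{ intros H0; apply (N t); rewrite Ealpha, H0; field; auto. }
assert (ND' : f2 t + 3 * f3 t * beta t <> 0) by (rewrite Rplus_comm; exact ND).
destruct (E t) as (xi & E0 & E1 & _ & E3); apply Exi in E3.
(* As [Ealpha] holds at all times it may be differentiated; the term [- alpha' / alpha] of degree 1
   then becomes the fraction in the first equation. *)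
rewrite (Derive_ext _ _ t Ealpha), EDalpha, E3, Ealpha in E1.
rewrite E3, Ealpha in E0.
split; [exact ND'|split].
- transitivity (f3 t * (c3 * ((3 * f3 t * beta t + f2 t) / (c2 * f3 t))) ^ 2
                / c3 * c1).
  + field; auto.
  + rewrite <- E1; field; auto.
(* The comparison in degree 0 is the second equation divided by [alpha t]. *)
- apply (Rmult_eq_reg_r
           (/ (c3 * ((3 * f3 t * beta t + f2 t) / (c2 * f3 t))))).
  + etransitivity; [|symmetry; exact E0]; field; auto.
  + rewrite <- Ealpha; apply Rinv_neq_0_compat, N.
Qed.

(** Converse computation: the choice of [alpha] matches degrees 3 and 2, and the two equations of
    the system match degrees 1 and 0, with factor [f3 alpha^2 / c3]. *)
Lemma gstar_of_system_solution
    (f0 f1 f2 f3 : R -> R) (c0 c1 c2 c3 : R)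
    (hf2 : smooth f2) (hf3 : smooth f3) (hf3_pos : forall t, 0 < f3 t)
    (hc2 : c2 <> 0) (hc3 : c3 <> 0) (beta : R -> R) (g : R -> affine) :
  system_solution f0 f1 f2 f3 c0 c1 c2 c3 beta ->
  smooth_curve g ->
  (forall t, trans (inv (g t)) = beta t) ->
  (forall t, scale (inv (g t)) =
             c3 * ((3 * f3 t * beta t + f2 t) / (c2 * f3 t))) ->
  forall t y, gstar g (abel f0 f1 f2 f3) t y =
    f3 t * (c3 * ((3 * f3 t * beta t + f2 t) / (c2 * f3 t))) ^ 2 / c3
    * cubic c0 c1 c2 c3 y.
Proof.
intros [Hb Hsys] Hg Ebeta Ealpha t y.
assert (N3 : f3 t <> 0) by apply Rgt_not_eq, hf3_pos.
destruct (Hsys t) as (ND & E1 & E0).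
assert (ND' : 3 * f3 t * beta t + f2 t <> 0) by (rewrite Rplus_comm; exact ND).
rewrite (gstar_abelE g f0 f1 f2 f3 t y Hg).
rewrite (Derive_ext _ _ t Ealpha), (Derive_ext _ _ t Ebeta).
rewrite Derive_alpha by auto.
rewrite Ealpha, Ebeta, <- E0.
(* The coefficient of [y], with [alpha' / alpha] expanded, is the right side of the first equation,
   so it is replaced by the left side. *)
match goal with |- _ + ?e * y + _ + _ = _ =>
  replace e with
    (c1 * c3 * (3 * f3 t * beta t + f2 t) ^ 2 / (c2 ^ 2 * f3 t))
    by (rewrite E1; field; auto)
end.
unfold cubic; field; auto.
Qed.

(** The condition [f2 + 3 f3 beta <> 0] together with [c3 <> 0] makes [alpha] nowhere zero, so
    [(beta, alpha)] is a curve in the affine group. *)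
Lemma affine_curve_of_system_solution
    (f0 f1 f2 f3 : R -> R) (c0 c1 c2 c3 : R)
    (hf2 : smooth f2) (hf3 : smooth f3) (hf3_pos : forall t, 0 < f3 t)
    (hc2 : c2 <> 0) (hc3 : c3 <> 0) (beta : R -> R) :
  system_solution f0 f1 f2 f3 c0 c1 c2 c3 beta ->
  exists g : R -> affine,
    smooth_curve g /\
    forall t, trans (inv (g t)) = beta t /\
      scale (inv (g t)) = c3 * ((3 * f3 t * beta t + f2 t) / (c2 * f3 t)).
Proof.
intros [Hb Hsys].
assert (N3 : forall t, f3 t <> 0) by (intros t; apply Rgt_not_eq, hf3_pos).
assert (N : forall t, c3 * ((3 * f3 t * beta t + f2 t) / (c2 * f3 t)) <> 0).
{ intros t; destruct (Hsys t) as [ND _]; rewrite Rplus_comm in ND.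
  unfold Rdiv.
  repeat first [ apply Rmult_integral_contrapositive_currified
               | apply Rinv_neq_0_compat ]; auto. }
(* The substitution is given by the inverse of [g], hence [g] is the inverse of [(beta, alpha)];
   inverting twice returns the pair. *)
exists (fun t => inv (Affine (beta t) _ (N t))); split.
- apply (smooth_curve_inv (fun t => Affine (beta t) _ (N t))).
  split; simpl; [exact Hb|].
  apply smooth_mult; [apply smooth_const|apply smooth_div].
  + intros t; apply Rmult_integral_contrapositive_currified; auto.
  + exact (smooth_plus _ _
      (smooth_mult _ _ (smooth_mult _ _ (smooth_const 3) hf3) Hb) hf2).
  + exact (smooth_mult _ _ (smooth_const c2) hf3).
- intros t; simpl; specialize (N t); revert N.
  generalize (c3 * ((3 * f3 t * beta t + f2 t) / (c2 * f3 t))); intros a N.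
  split; field; exact N.
Qed.

Theorem theorem7p2 (f0 f1 f2 f3 : R -> R) (c0 c1 c2 c3 : R)
  (hf0 : smooth f0) (hf1 : smooth f1) (hf2 : smooth f2) (hf3 : smooth f3)
  (hf3_pos : forall t : R, 0 < f3 t)
  (hc : c3 * c2 <> 0) :
  (abel_quasi_lie_system (line (cubic c0 c1 c2 c3)) (abel f0 f1 f2 f3) <->
   exists beta : R -> R, system_solution f0 f1 f2 f3 c0 c1 c2 c3 beta) /\
  (forall beta : R -> R,
     system_solution f0 f1 f2 f3 c0 c1 c2 c3 beta ->
     let alpha := fun t : R =>
       c3 * ((3 * f3 t * beta t + f2 t) / (c2 * f3 t)) in
     exists g : R -> affine,
       smooth_curve g /\
       (forall t : R,
          trans (inv (g t)) = beta t /\ scale (inv (g t)) = alpha t) /\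
       lie_system (line (cubic c0 c1 c2 c3)) (gstar g (abel f0 f1 f2 f3)) /\
       maps_onto alpha beta (abel f0 f1 f2 f3) (gstar g (abel f0 f1 f2 f3)) /\
       exists xi : R -> R,
         smooth xi /\
         forall t y : R,
           gstar g (abel f0 f1 f2 f3) t y = xi t * cubic c0 c1 c2 c3 y).
Proof.
assert (hc2 : c2 <> 0) by (intros ->; apply hc; ring).
assert (hc3 : c3 <> 0) by (intros ->; apply hc; ring).
assert (Hline := lie_algebra_line _ (smooth_cubic c0 c1 c2 c3)).
split.
- split.
  + intros (_ & _ & _ & _ & g & Hg & HV).
    exists (fun t => trans (inv (g t))).
    apply system_solution_of_gstar; auto.
  + intros [beta Hbeta].
    split; [exact quasi_lie_scheme_Abel|].
    split; [apply V_Abel_abel|].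
    split; [exact Hline|].
    split; [apply included_line_cubic|].
    destruct (affine_curve_of_system_solution f0 f1 f2 f3 c0 c1 c2 c3
                hf2 hf3 hf3_pos hc2 hc3 beta Hbeta) as (g & Hg & Eg).
    exists g; split; [exact Hg|]; intros t; apply lineP.
    (* The multiple is found by unification with the explicit factor [f3 alpha^2 / c3]. *)
    eexists; intros y.
    apply (gstar_of_system_solution f0 f1 f2 f3 c0 c1 c2 c3
             hf2 hf3 hf3_pos hc2 hc3 beta g); auto; intros s; apply Eg.
- intros beta Hbeta alpha.
  destruct (affine_curve_of_system_solution f0 f1 f2 f3 c0 c1 c2 c3
              hf2 hf3 hf3_pos hc2 hc3 beta Hbeta) as (g & Hg & Eg).
  change (forall t, trans (inv (g t)) = beta t /\ scale (inv (g t)) = alpha t)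
    in Eg.
  assert (Hxi : forall t y, gstar g (abel f0 f1 f2 f3) t y =
                  f3 t * alpha t ^ 2 / c3 * cubic c0 c1 c2 c3 y).
  { apply gstar_of_system_solution; auto; intros s; apply Eg. }
  assert (Halpha : smooth alpha).
  { apply (smooth_ext (fun t => scale (inv (g t)))).
    - intros t; apply Eg.
    - apply (smooth_curve_inv g Hg). }
  exists g; split; [exact Hg|split; [exact Eg|split; [split|split]]].
  + exact Hline.
  + intros t; apply lineP; eexists; apply Hxi.
  + apply maps_onto_affine; [exact Halpha|apply Hbeta| |].
    * intros t; rewrite <- (proj2 (Eg t)); apply scale_neq0.
    (* The coefficients of the inverse curve agree with [alpha] and [beta] at every time, so their
       derivatives agree too. *)
    * intros t y; rewrite (gstarE g _ t y Hg).
      rewrite (Derive_ext _ _ t (fun s => proj1 (Eg s))).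
      rewrite (Derive_ext _ _ t (fun s => proj2 (Eg s))).
      rewrite (proj1 (Eg t)), (proj2 (Eg t)); reflexivity.
  + exists (fun t => f3 t * alpha t ^ 2 / c3); split; [|exact Hxi].
    apply smooth_div; [auto| |apply smooth_const].
    exact (smooth_mult _ _ hf3 (smooth_pow _ 2 Halpha)).
Qed.
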